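(* Let $n\ge 1$ and let $\alpha_0,\gamma_0,\alpha_i,\beta_i,\gamma_i,\delta_i\in\mathbb{C}$ ($i=1,\dots,n$) be parameters such that the rational function $$H(x^1,\dots,x^n)=\frac{\alpha_0+\sum_{i=1}^n\alpha_i x^i+\sum_{i=1}^n\beta_i/x^i}{\gamma_0+\sum_{i=1}^n\gamma_i x^i+\sum_{i=1}^n\delta_i/x^i}$$ is well defined and, for each $k\in\{1,\dots,n\}$, has degree exactly $2$ as a rational function of $x^k$ over the field of rational functions in the remaining variables (superscripts on $x$ are indices, not powers). Then the Tsuda map $\phi$ associated to the integral $H$ is the map $$\phi:(x^1,\dots,x^n)\mapsto(X^1,\dots,X^n),\qquad X^i=\frac{1}{x^i}\,\frac{\beta_i-\delta_i H(x^1,\dots,x^n)}{\alpha_i-\gamma_i H(x^1,\dots,x^n)},\quad i=1,\dots,n.$$ It is an involution, i.e. $\phi\circ\phi=\mathrm{id}$ as rational maps, and moreover it is a $2^n$-rational map in the narrow sense, i.e. the map, its companion maps and their inverses all have the same functional form.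
   Context: All maps are rational maps of $(\mathbb{CP}^1)^n=\mathbb{CP}^1\times\cdots\times\mathbb{CP}^1$ ($n$ factors) over $\mathbb{C}$; equalities of maps are equalities of rational maps (i.e. hold at generic points). Tsuda map. Let $H$ be a rational function on $(\mathbb{CP}^1)^n$ that is a ratio of two polynomials of degree at most $2$ in each variable, and of degree exactly $2$ in each variable $x^k$. For each $k$ the equation $H(x^1,\dots,X^k,\dots,x^n)=H(x^1,\dots,x^k,\dots,x^n)$ (only the $k$-th argument is changed) has two solutions for $X^k$: the trivial one $X^k=x^k$ and a second, non-trivial one. The involution $\sigma^k$ sends $(x^1,\dots,x^k,\dots,x^n)$ to $(x^1,\dots,X^k,\dots,x^n)$ with $X^k$ the non-trivial solution. The Tsuda map associated to the integral $H$ is the composition $\phi=\sigma^n\circ\cdots\circ\sigma^1$; thus, with $\phi(x^1,\dots,x^n)=(X^1,\dots,X^n)$, one has $H(x^1,\dots,x^n)=H(X^1,\dots,X^m,x^{m+1},\dots,x^n)$ for all $m\in\{1,\dots,n\}$. $2^n$-rational maps. Let $R:(\mathbb{CP}^1)^n\to(\mathbb{CP}^1)^n$, $(x^1,\dots,x^n)\mapsto(X^1,\dots,X^n)$, be a rational map. For a subset $m\subseteq M:=\{1,\dots,n\}$ with complement $m^c=M\setminus m$, let $\mathcal{X}^m$ be the $n$-tuple whose $i$-th entry is $X^i$ if $i\in m$ and $x^i$ if $i\notin m$; correspondingly $\mathcal{X}^{m^c}$ has $i$-th entry $x^i$ if $i\in m$ and $X^i$ if $i\notin m$. $R$ is $2^n$-rational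 if for each of the $2^n$ subsets $m\subseteq M$ the map $R^{c_m}:\mathcal{X}^m\mapsto\mathcal{X}^{m^c}$, obtained by solving the relation $(X^1,\dots,X^n)=R(x^1,\dots,x^n)$ for the entries of $\mathcal{X}^{m^c}$ in terms of those of $\mathcal{X}^m$, is (well defined and) a rational map. That is, $x\mapsto\mathcal{X}^m$ is birational and $R^{c_m}$ is the composition of its inverse with $x\mapsto\mathcal{X}^{m^c}$. The maps $R^{c_m}$ are the companion maps of $R$ ($R^{c_\emptyset}=R$, $R^{c_M}=R^{-1}$). $R$ is $2^n$-rational in the narrow sense if in addition all the companion maps and their inverses have the same functional form as $R$, i.e. they are given by the same formulas as $R$ with $(x^1,\dots,x^n)$ replaced by the entries of the input tuple (so that, as rational self-maps of $(\mathbb{CP}^1)^n$, they coincide with $R$). *)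

(* Defs.v *)
From mathcomp Require Export all_boot all_order all_algebra.
From mathcomp Require Export fraction complex reals.
From mathcomp Require Export mpoly.

Set Implicit Arguments.
Unset Strict Implicit.
Unset Printing Implicit Defensive.

Import GRing.Theory.

Local Open Scope ring_scope.

(* The function field F(x_1, ..., x_n) of (P^1)^n. *)
Notation ratfun F n := {fraction {mpoly F[n]}}.

(* A rational map (P^1)^n --> (P^1)^n is a tuple of rational functions with
   values in P^1; it is encoded by a tuple of elements of the function field.
   Only maps having a coordinate identically equal to infinity are left out:
   these are not dominant, so they are neither birational nor composites of
   birational maps.  Equality of such tuples is equality at generic points. *)
Notation ratmap F n := {ffun 'I_n -> ratfun F n}.

Section RationalMaps.

Variables (F : fieldType) (n : nat).
Implicit Types (f g h : ratfun F n) (u v w R C S : ratmap F n) (k : 'I_n).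

Definition rconst (c : F) : ratfun F n := tofrac c%:MP.

Definition rvar k : ratfun F n := tofrac 'X_k.

Definition ratmap_id : ratmap F n := [ffun k => rvar k].

(* P(u_1, ..., u_n) for a polynomial P. *)
Definition mpoly_subst (P : {mpoly F[n]}) u : ratfun F n := mmap rconst u P.

(* g = f(u_1, ..., u_n).  This is a relation since the composite is undefined
   when u maps into the indeterminacy locus of f; g is unique if it exists. *)
Definition ratfun_comp f u g : Prop :=
  exists P Q : {mpoly F[n]},
    [/\ Q != 0, f = tofrac P / tofrac Q,
        mpoly_subst Q u != 0 & g = mpoly_subst P u / mpoly_subst Q u].

(* w is the composite of v after u. *)
Definition ratmap_comp v u w : Prop := forall i, ratfun_comp (v i) u (w i).

(* w is the composite s_r o ... o s_1 of the list [:: s_1; ...; s_r]. *)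
Fixpoint ratmap_comp_seq (s : seq (ratmap F n)) w : Prop :=
  if s is u :: s' then
    exists2 v, ratmap_comp_seq s' v & ratmap_comp v u w
  else w = ratmap_id.

Definition ratmap_inverse u v : Prop :=
  ratmap_comp u v ratmap_id /\ ratmap_comp v u ratmap_id.

(* f belongs to the field of rational functions in the variables x_j, j != k. *)
Definition free_of_var k f : Prop :=
  exists P Q : {mpoly F[n]},
    [/\ forall m, m \in msupp P -> m k = 0%N,
        forall m, m \in msupp Q -> m k = 0%N,
        Q != 0 & f = tofrac P / tofrac Q].

(* f has degree d as a rational function of x_k over the field of rational
   functions in the other variables: the maximum of the degrees of the
   numerator and denominator in lowest terms. *)
Definition degree_in_var k f (d : nat) : Prop :=
  exists p q : {poly ratfun F n},
    [/\ (forall i, free_of_var k p`_i) /\ (forall i, free_of_var k q`_i),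
        coprimep p q,
        q.[rvar k] != 0,
        f = p.[rvar k] / q.[rvar k]
      & maxn (size p).-1 (size q).-1 = d].

(* s = sigma^k: it changes the k-th coordinate only, to the solution X of
   H(x_1, ..., X, ..., x_n) = H(x_1, ..., x_n) other than X = x_k.  In
   characteristic 0, if H has degree exactly 2 in x_k, that solution lies in
   the function field: it is a Moebius transform of x_k with coefficients free
   of x_k, hence neither infinity nor x_k, and it is unique. *)
Definition is_sigma (H : ratfun F n) k (s : ratmap F n) : Prop :=
  [/\ forall j, j != k -> s j = rvar j,
      s k != rvar k
    & ratfun_comp H s H].

(* phi = sigma^n o ... o sigma^1. *)
Definition is_tsuda_map (H : ratfun F n) (phi : ratmap F n) : Prop :=
  exists2 sigma : 'I_n -> ratmap F n,
    forall k, is_sigma H k (sigma k)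
    & ratmap_comp_seq [seq sigma k | k <- enum 'I_n] phi.

(* The map x |-> \mathcal{X}^m. *)
Definition mixed R (m : {set 'I_n}) : ratmap F n :=
  [ffun i => if i \in m then R i else rvar i].

(* C = R^{c_m}; in particular x |-> \mathcal{X}^m is birational. *)
Definition is_companion R (m : {set 'I_n}) C : Prop :=
  exists2 S, ratmap_inverse (mixed R m) S & ratmap_comp (mixed R (~: m)) S C.

Definition two_n_rational R : Prop := forall m, exists C, is_companion R m C.

Definition two_n_rational_narrow R : Prop :=
  two_n_rational R /\
  forall m C, is_companion R m C -> C = R /\ ratmap_inverse C R.

(* a_0 + sum_i a_i x_i + sum_i b_i / x_i *)
Definition laurent_sum (a0 : F) (a b : 'I_n -> F) : ratfun F n :=
  rconst a0 + \sum_i rconst (a i) * rvar i + \sum_i rconst (b i) / rvar i.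

End RationalMaps.

(* Main.v *)
(* Put A_i = alpha_i - gamma_i H and B_i = beta_i - delta_i H.  Clearing the
   denominator of H gives alpha_0 - gamma_0 H + sum_i (A_i x_i + B_i / x_i) = 0,
   and each term A_i x_i + B_i / x_i is invariant under x_i -> X_i =
   B_i / (A_i x_i).  Hence H keeps its value when any subset m of the
   coordinates x_i is replaced by X_i.  So the maps u_m = [mixed phi m] are
   involutions with u_m o u_m' = u_(m xor m'), and sigma^k = u_{k}, phi = u_M,
   and the companion R^{c_m} is u_(~ m) o u_m = phi.
   The substitutions must avoid the indeterminacy locus of H.  For u_{k} this
   holds because the numerator and denominator of H are coprime in x_k; for
   general m it follows by induction, since composition with an involution is
   injective on the function field. *)
Require Import Defs.
From HB Require Import structures.
From mathcomp Require Import ring zify.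

Set Implicit Arguments.
Unset Strict Implicit.
Unset Printing Implicit Defensive.

Import GRing.Theory Num.Theory.

Local Open Scope ring_scope.

(** * Quadratics, Vieta's formulas and coprime polynomials over a field *)

Section FieldAlgebra.

Variable K : fieldType.
Implicit Types (a b c h r x y : K) (p q u v : {poly K}).

(** Vieta: subtracting the two equations and cancelling [y - x] gives the sum of the roots, and then
    their product [c / a]. *)
Lemma quadratic_other_root a b c x y :
    a != 0 -> x != 0 -> y != x ->
    c + b * x + a * x ^+ 2 = 0 -> c + b * y + a * y ^+ 2 = 0 ->
  y = x^-1 * (c / a).
Proof.
move=> a0 x0 yx ex ey.
have e : (y - x) * (b + a * (y + x)) = 0.
  by rewrite -[RHS](subrr 0) -{1}ey -ex; ring.
have {}e : b = - a * (y + x).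
  by move/eqP: e; rewrite mulf_eq0 subr_eq0 (negPf yx) addr_eq0 mulNr => /eqP.
have -> : c = a * x * y by rewrite -[LHS]subr0 -ex e; ring.
by field; rewrite x0 a0.
Qed.

Lemma quadratic_double_root a b c x :
    a != 0 -> x != 0 ->
    c + b * x + a * x ^+ 2 = 0 -> x^-1 * (c / a) = x ->
  b + 2 * a * x = 0.
Proof.
move=> a0 x0 ex e; have ec : c = a * x ^+ 2.
  by rewrite expr2 -{2}e; field; rewrite x0 a0.
apply: (mulfI x0); rewrite mulr0 -ex ec; ring.
Qed.

(** The map [x] to [c / (a * x)] swaps the two summands. *)
Lemma involution_term a c x :
    a != 0 -> c != 0 -> x != 0 ->
  a * (x^-1 * (c / a)) + c / (x^-1 * (c / a)) = a * x + c / x.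
Proof. by move=> a0 c0 x0; field; rewrite c0 a0 x0. Qed.

Lemma involution_twice a c x :
  a != 0 -> c != 0 -> x != 0 -> (x^-1 * (c / a))^-1 * (c / a) = x.
Proof. by move=> a0 c0 x0; field; rewrite c0 a0 x0. Qed.

(** [Poly] drops leading zeros, so [a] may vanish. *)
Definition quadratic c b a : {poly K} := Poly [:: c; b; a].

Lemma horner_quadratic c b a x : (quadratic c b a).[x] = c + b * x + a * x ^+ 2.
Proof. by rewrite horner_Poly /=; ring. Qed.

Lemma horner_deriv_quadratic c b a x :
  (quadratic c b a)^`().[x] = b + 2 * a * x.
Proof.
have -> : quadratic c b a = c%:P + b *: 'X + a *: 'X^2.
  apply/polyP => i; rewrite coef_Poly !coefD coefC !coefZ coefX coefXn.
  by case: i => [|[|[|i]]] /=; rewrite ?nth_nil; ring.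
by rewrite !derivE !hornerE; ring.
Qed.

Lemma laurent_clear a b r (S T : K) y : y != 0 ->
  b + (r + S + T) * y + a * y ^+ 2 = y * (r + (a * y + S) + (b / y + T)).
Proof. by move=> y0; field. Qed.

Lemma quadratic_pencil c b a c' b' a' h y :
  (quadratic c b a).[y] - h * (quadratic c' b' a').[y] =
  (c - c' * h) + (b - b' * h) * y + (a - a' * h) * y ^+ 2.
Proof. by rewrite !horner_quadratic; ring. Qed.

Lemma pencil_deriv a b a' b' h y :
  (b + 2 * a * y) - h * (b' + 2 * a' * y) =
  (b - b' * h) + 2 * (a - a' * h) * y.
Proof. by ring. Qed.

Lemma sumr_pencil (I : finType) (a a' w : I -> K) h :
  \sum_i a i * w i - h * (\sum_i a' i * w i) = \sum_i (a i - a' i * h) * w i.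
Proof.
rewrite mulr_sumr -sumrB; apply: eq_bigr => i _; ring.
Qed.

Lemma pencil_split a a' h (S S' T T' : K) :
  (a + S + T) - h * (a' + S' + T') =
  (a - a' * h) + ((S - h * S') + (T - h * T')).
Proof. by ring. Qed.

Lemma size_quadratic c b a : (size (quadratic c b a) <= 3)%N.
Proof. exact: size_Poly. Qed.

Lemma size_quadratic0 c b : (size (quadratic c b 0) <= 2)%N.
Proof.
apply/leq_sizeP => -[|[|[|j]]] //= _; rewrite coef_Poly //=.
by rewrite nth_nil.
Qed.

(** Here [q] divides both polynomials, hence their constant gcd. *)
Lemma coprimep_scale_size p q c :
  coprimep p q -> p = c *: q -> (size p <= 1)%N /\ (size q <= 1)%N.
Proof.
move=> pq e; have q1 : (size q <= 1)%N.
  have : q %| gcdp p q by rewrite dvdp_gcd dvdpp e -mul_polyC dvdp_mulIr.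
  move/dvdp_leq; rewrite -size_poly_eq0 (eqP pq) => /(_ isT) //.
by rewrite q1 e (leq_trans (size_scale_leq _ _) q1).
Qed.

Lemma deriv_eq0_size p : [pchar K] =i pred0 -> p^`() = 0 -> (size p <= 1)%N.
Proof.
move=> char0 p0; apply/leq_sizeP => -[//|j] _.
have /eqP : p^`()`_j = 0 by rewrite p0 coef0.
by rewrite coef_deriv -mulr_natr mulf_eq0 ((pcharf0P _).1 char0) orbF => /eqP.
Qed.

Lemma coprimep_wronskian_size p q :
    [pchar K] =i pred0 -> coprimep p q -> p^`() * q = p * q^`() ->
  (size p <= 1)%N /\ (size q <= 1)%N.
Proof.
move=> char0.
have half p1 q1 :
    coprimep p1 q1 -> p1^`() * q1 = p1 * q1^`() -> (size p1 <= 1)%N.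
  move=> pq e; have [->|p0] := eqVneq p1 0; first by rewrite size_poly0.
  have : p1 %| p1^`() by rewrite -(Gauss_dvdpl _ pq) e dvdp_mulr.
  have [/(deriv_eq0_size char0)//|d0] := eqVneq p1^`() 0.
  by move/(dvdp_leq d0); rewrite leqNgt lt_size_deriv.
move=> pq e; split; first exact: half pq e.
by apply: (half q p); rewrite 1?coprimep_sym // mulrC -e mulrC.
Qed.

(* If [u / v = p / q] with [p / q] in lowest terms of degree [d], then [u] and
   [v] are a common multiple of [p] and [q], by a constant for lack of room. *)
Lemma coprimep_of_degree p q u v (d : nat) :
    coprimep p q -> q != 0 -> v != 0 -> p * v = u * q ->
    maxn (size p).-1 (size q).-1 = d.+1 ->
    (size u <= d.+2)%N -> (size v <= d.+2)%N ->
  coprimep u v /\ maxn (size u).-1 (size v).-1 = d.+1.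
Proof.
move=> pq q0 v0 e deg su sv.
have /dvdpP [r ev] : q %| v.
  by rewrite -(Gauss_dvdpr _ (_ : coprimep q p)) 1?coprimep_sym // e dvdp_mull.
have eu : u = r * p by apply: (mulIf q0); rewrite -e ev; ring.
have r0 : r != 0 by apply: contraNneq v0 => r0; rewrite ev r0 mul0r.
have /size_poly1P [c c0 er] : size r == 1.
  rewrite eqn_leq size_poly_gt0 r0 andbT.
  have [] : (size p = d.+2 \/ size q = d.+2)%N.
  - move: deg; rewrite maxnE; case: (size p) (size q) => [|i] [|j] /=; lia.
  - move=> sp; have p0 : p != 0 by rewrite -size_poly_eq0 sp.
    move: su; rewrite eu size_mul //.
    by rewrite sp addnS /= -[d.+2]add1n leq_add2r.
  - move=> sq; move: sv; rewrite ev size_mul //.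
    by rewrite sq addnS /= -[d.+2]add1n leq_add2r.
rewrite eu ev er !mul_polyC !size_scale // coprimepZl // coprimepZr //.
Qed.

End FieldAlgebra.

(** * Calculus of composition in the function field *)

Section Composition.

Variables (F : fieldType) (n : nat).
Implicit Types (f g : ratfun F n) (u v w z s : ratmap F n) (P Q : {mpoly F[n]}).

HB.instance Definition _ :=
  GRing.RMorphism.copy (@rconst F n) (@tofrac _ \o @mpolyC n F).

Lemma mpoly_substD P Q u :
  mpoly_subst (P + Q) u = mpoly_subst P u + mpoly_subst Q u.
Proof. exact: rmorphD. Qed.

Lemma mpoly_substN P u : mpoly_subst (- P) u = - mpoly_subst P u.
Proof. exact: rmorphN. Qed.

Lemma mpoly_substM P Q u :
  mpoly_subst (P * Q) u = mpoly_subst P u * mpoly_subst Q u.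
Proof. exact: rmorphM. Qed.

Lemma mpoly_substC u c : mpoly_subst c%:MP u = rconst n c.
Proof. exact: mmapC. Qed.

Lemma mpoly_subst1 u : mpoly_subst 1 u = 1.
Proof. by rewrite -[1]/(1%:MP) mpoly_substC rmorph1. Qed.

Lemma mpoly_substX u i : mpoly_subst 'X_i u = u i.
Proof. by rewrite /mpoly_subst mmapX mmap1U. Qed.

Lemma mpoly_subst_free k P s :
    (forall m, m \in msupp P -> m k = 0%N) ->
    (forall j, j != k -> s j = rvar F j) ->
  mpoly_subst P s = tofrac P.
Proof.
move=> Pk sk; rewrite {2}[P]mpolyE rmorph_sum /mpoly_subst /mmap.
rewrite !big_seq; apply: eq_bigr => m mP.
rewrite -mul_mpolyC rmorphM /=; congr (_ * _).
rewrite mpolyXE_id rmorph_prod; apply: eq_bigr => i _.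
rewrite rmorphXn /=; have [->|/sk ->//] := eqVneq i k.
by rewrite (Pk m mP) !expr0.
Qed.

Lemma mpoly_subst_id P : mpoly_subst P (ratmap_id F n) = tofrac P.
Proof.
rewrite {2}[P]mpolyE rmorph_sum /mpoly_subst /mmap; apply: eq_bigr => m _.
rewrite -mul_mpolyC rmorphM /=; congr (_ * _).
rewrite mpolyXE_id rmorph_prod; apply: eq_bigr => i _.
by rewrite rmorphXn /= ffunE.
Qed.

Lemma ratfun_comp_mpoly P u : ratfun_comp (tofrac P) u (mpoly_subst P u).
Proof.
by exists P, 1; rewrite mpoly_subst1 tofrac1 !divr1; split; rewrite ?oner_eq0.
Qed.

Lemma ratfun_comp_const c u : ratfun_comp (rconst n c) u (rconst n c).
Proof. by rewrite -{2}(mpoly_substC u); apply: ratfun_comp_mpoly. Qed.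

Lemma ratfun_comp0 u : ratfun_comp 0 u 0.
Proof. by have := ratfun_comp_const 0 u; rewrite rmorph0. Qed.

Lemma ratfun_comp_var i u : ratfun_comp (rvar F i) u (u i).
Proof. by rewrite -mpoly_substX; apply: ratfun_comp_mpoly. Qed.

(** Two fractions for [f] cross-multiply to a polynomial identity, which survives substitution. *)
Lemma ratfun_comp_uniq f u g h :
  ratfun_comp f u g -> ratfun_comp f u h -> g = h.
Proof.
move=> [P [Q [Q0 -> Qu ->]]] [P' [Q' [Q'0 /eqP e Q'u ->]]].
have tQ0 : tofrac Q != 0 by rewrite tofrac_eq0.
have tQ'0 : tofrac Q' != 0 by rewrite tofrac_eq0.
move: e; rewrite (eqr_div _ _ tQ0 tQ'0) -!tofracM tofrac_eq => /eqP e.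
by apply/eqP; rewrite (eqr_div _ _ Qu Q'u) -!mpoly_substM e.
Qed.

Lemma ratfun_compD f f' u g g' :
    ratfun_comp f u g -> ratfun_comp f' u g' ->
  ratfun_comp (f + f') u (g + g').
Proof.
move=> [P [Q [Q0 -> Qu ->]]] [P' [Q' [Q'0 -> Q'u ->]]].
have tQ0 : tofrac Q != 0 by rewrite tofrac_eq0.
have tQ'0 : tofrac Q' != 0 by rewrite tofrac_eq0.
exists (P * Q' + P' * Q), (Q * Q').
rewrite (addf_div _ _ tQ0 tQ'0) (addf_div _ _ Qu Q'u).
rewrite tofracD !tofracM mpoly_substD !mpoly_substM.
by split; [exact: (mulf_neq0 Q0 Q'0) | | exact: (mulf_neq0 Qu Q'u) |].
Qed.

Lemma ratfun_compN f u g : ratfun_comp f u g -> ratfun_comp (- f) u (- g).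
Proof.
move=> [P [Q [Q0 -> Qu ->]]]; exists (- P), Q.
by rewrite mpoly_substN tofracN !mulNr.
Qed.

Lemma ratfun_compB f f' u g g' :
    ratfun_comp f u g -> ratfun_comp f' u g' ->
  ratfun_comp (f - f') u (g - g').
Proof. by move=> fg /ratfun_compN; apply: ratfun_compD. Qed.

Lemma ratfun_compM f f' u g g' :
    ratfun_comp f u g -> ratfun_comp f' u g' ->
  ratfun_comp (f * f') u (g * g').
Proof.
move=> [P [Q [Q0 -> Qu ->]]] [P' [Q' [Q'0 -> Q'u ->]]].
exists (P * P'), (Q * Q').
rewrite !mpoly_substM !tofracM.
split; [exact: (mulf_neq0 Q0 Q'0) | by rewrite -mulf_div | |].
  exact: (mulf_neq0 Qu Q'u).
by rewrite -mulf_div.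
Qed.

Lemma ratfun_compV f u g :
  ratfun_comp f u g -> g != 0 -> ratfun_comp f^-1 u g^-1.
Proof.
move=> [P [Q [Q0 -> Qu ->]]]; rewrite mulf_eq0 negb_or => /andP[Pu _].
exists Q, P; rewrite !invf_div; split=> //.
by apply: contraNneq Pu => ->; rewrite /mpoly_subst rmorph0.
Qed.

Lemma ratfun_comp_div f f' u g g' :
    ratfun_comp f u g -> ratfun_comp f' u g' -> g' != 0 ->
  ratfun_comp (f / f') u (g / g').
Proof. by move=> fg f'g' /(ratfun_compV f'g'); apply: ratfun_compM. Qed.

Lemma ratfun_compX f u g k :
  ratfun_comp f u g -> ratfun_comp (f ^+ k) u (g ^+ k).
Proof.
move=> fg; elim: k => [|k IH]; last by rewrite !exprS; apply: ratfun_compM.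
by rewrite !expr0 -(rmorph1 (@rconst F n)); apply: ratfun_comp_const.
Qed.

Lemma ratfun_comp_sum (I : Type) (r : seq I) (D : pred I)
    (f g : I -> ratfun F n) u :
    (forall i, D i -> ratfun_comp (f i) u (g i)) ->
  ratfun_comp (\sum_(i <- r | D i) f i) u (\sum_(i <- r | D i) g i).
Proof.
move=> fg; elim/big_rec2: _ => [|i x y /fg]; first exact: ratfun_comp0.
exact: ratfun_compD.
Qed.

Lemma ratfun_comp_prod (I : Type) (r : seq I) (D : pred I)
    (f g : I -> ratfun F n) u :
    (forall i, D i -> ratfun_comp (f i) u (g i)) ->
  ratfun_comp (\prod_(i <- r | D i) f i) u (\prod_(i <- r | D i) g i).
Proof.
move=> fg; elim/big_rec2: _ => [|i x y /fg]; last exact: ratfun_compM.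
by rewrite -(rmorph1 (@rconst F n)); apply: ratfun_comp_const.
Qed.

(** Associativity of composition for a polynomial outer function, where no denominator can
    vanish. *)
Lemma ratfun_comp_subst P w u z :
  ratmap_comp w u z -> ratfun_comp (mpoly_subst P w) u (mpoly_subst P z).
Proof.
move=> wuz; apply: ratfun_comp_sum => m _.
apply: ratfun_compM; first exact: ratfun_comp_const.
by apply: ratfun_comp_prod => i _; apply: ratfun_compX.
Qed.

Lemma ratmap_comp_uniq v u w w' :
  ratmap_comp v u w -> ratmap_comp v u w' -> w = w'.
Proof.
by move=> h h'; apply/ffunP => i; apply: ratfun_comp_uniq (h i) (h' i).
Qed.

Lemma ratmap_comp_id u : ratmap_comp (ratmap_id F n) u u.
Proof. by move=> i; rewrite ffunE; apply: ratfun_comp_var. Qed.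

(* Composing [Q(u) = 0] with a right inverse of [u] gives [Q = 0]. *)
Lemma mpoly_subst_neq0 u v Q :
  ratmap_comp u v (ratmap_id F n) -> Q != 0 -> mpoly_subst Q u != 0.
Proof.
move=> uv; apply: contraNneq => Qu.
have := ratfun_comp_subst Q uv; rewrite Qu mpoly_subst_id.
by move/ratfun_comp_uniq/(_ (ratfun_comp0 v))/eqP; rewrite tofrac_eq0.
Qed.

(** The numerator of [f] does not vanish under [u], since [u] has the right inverse [v]. *)
Lemma ratfun_comp_neq0 u v f g :
    ratmap_comp u v (ratmap_id F n) -> ratfun_comp f u g -> f != 0 -> g != 0.
Proof.
move=> uv [P [Q [Q0 -> Qu ->]]] f0.
have P0 : P != 0 by apply: contraNneq f0 => ->; rewrite tofrac0 mul0r.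
exact: (mulf_neq0 (mpoly_subst_neq0 uv P0) (invr_neq0 Qu)).
Qed.

(** With [s i = P / Q], the identity x_i = P(u) / Q(u) composed with the involution [u] reads
    [u i = P / Q]. *)
Lemma ratmap_involution_inverse u s :
    ratmap_comp u u (ratmap_id F n) -> ratmap_comp s u (ratmap_id F n) ->
  s = u.
Proof.
move=> uu su; apply/ffunP => i; have [P [Q [Q0 e Qu e']]] := su i.
have := ratfun_comp_div (ratfun_comp_subst P uu) (ratfun_comp_subst Q uu).
rewrite !mpoly_subst_id tofrac_eq0 Q0 -e -e' ffunE => /(_ isT) h.
exact: ratfun_comp_uniq h (ratfun_comp_var i u).
Qed.

(** A form of [free_of_var] by invariance under substitution, which passes to sums and products
    without handling fractions. *)
Definition indep_of_var k f : Prop :=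
  forall s, (forall j, j != k -> s j = rvar F j) -> ratfun_comp f s f.

Lemma free_of_var_indep k f : free_of_var k f -> indep_of_var k f.
Proof.
move=> [P [Q [Pk Qk Q0 ->]]] s sk; exists P, Q.
by rewrite (mpoly_subst_free Pk sk) (mpoly_subst_free Qk sk) tofrac_eq0.
Qed.

Lemma ratfun_comp_horner k (p : {poly ratfun F n}) s :
    (forall i, indep_of_var k p`_i) -> (forall j, j != k -> s j = rvar F j) ->
  ratfun_comp p.[rvar F k] s p.[s k].
Proof.
move=> pk sk; rewrite !horner_coef; apply: ratfun_comp_sum => i _.
by apply: ratfun_compM (pk i s sk) (ratfun_compX _ (ratfun_comp_var k s)).
Qed.

Hypothesis char0 : [pchar F] =i pred0.

(* Substituting the natural numbers for [x_k] produces infinitely many roots. *)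
Lemma horner_rvar_eq0 k (p : {poly ratfun F n}) :
  (forall i, indep_of_var k p`_i) -> p.[rvar F k] = 0 -> p = 0.
Proof.
move=> pk p0; have root_p c : root p c.
  pose s : ratmap F n := [ffun j => if j == k then c else rvar F j].
  have sk j : j != k -> s j = rvar F j by rewrite ffunE => /negPf->.
  have := ratfun_comp_horner pk sk; rewrite p0 ffunE eqxx => h.
  by rewrite /root (ratfun_comp_uniq h (ratfun_comp0 s)).
have [//|p_neq0] := eqVneq p 0.
pose rs : seq (ratfun F n) := [seq i%:R | i <- iota 0 (size p)].
suff: (size rs < size p)%N by rewrite size_map size_iota ltnn.
apply: max_poly_roots => //; first by apply/allP => c _; apply: root_p.
rewrite map_inj_uniq ?iota_uniq // => i j.
rewrite -!(rmorph_nat (@rconst F n)) => /fmorph_inj.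
wlog le_ij: i j / (i <= j)%N => [H|].
  by case/orP: (leq_total i j) => /H // h /esym/h.
move/esym/eqP; rewrite -subr_eq0 -natrB // ((pcharf0P _).1 char0).
rewrite subn_eq0 => ji.
by apply/eqP; rewrite eqn_leq le_ij.
Qed.

End Composition.

(** * Laurent sums as quadratics in one variable *)

Section Laurent.

Variables (F : fieldType) (n : nat).
Implicit Types (a b : 'I_n -> F) (u w z : ratmap F n).

Lemma rvar_neq0 i : rvar F i != 0 :> ratfun F n.
Proof.
rewrite /rvar tofrac_eq0; apply/eqP => /(congr1 (mcoeff U_(i)%MM)).
by rewrite mcoeffX eqxx mcoeff0 => /eqP; rewrite oner_eq0.
Qed.

(** The value of [laurent_sum] at [w]. As [_ / 0] is [0], it is known to be the composite only when
    no [w i] vanishes. *)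
Definition laurent_at c a b w : ratfun F n :=
  rconst n c + \sum_i rconst n (a i) * w i + \sum_i rconst n (b i) / w i.

Lemma laurent_at_id c a b :
  laurent_at c a b (ratmap_id F n) = laurent_sum c a b.
Proof.
by rewrite /laurent_at; congr (_ + _ + _); apply: eq_bigr => i _; rewrite ffunE.
Qed.

Lemma ratfun_comp_laurent c a b w u z :
    ratmap_comp w u z -> (forall i, z i != 0) ->
  ratfun_comp (laurent_at c a b w) u (laurent_at c a b z).
Proof.
move=> wuz z0; apply: ratfun_compD.
  apply: ratfun_compD; first exact: ratfun_comp_const.
  apply: ratfun_comp_sum => i _.
  exact: ratfun_compM (ratfun_comp_const _ _) (wuz i).
apply: ratfun_comp_sum => i _.
exact: ratfun_comp_div (ratfun_comp_const _ _) (wuz i) (z0 i).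
Qed.

(** The part of the Laurent sum without x_k; it becomes the linear coefficient after multiplication
    by x_k. *)
Definition laurent_rest c a b k : ratfun F n :=
  rconst n c + \sum_(j | j != k) rconst n (a j) * rvar F j
    + \sum_(j | j != k) rconst n (b j) / rvar F j.

Lemma laurent_rest_indep c a b k : indep_of_var k (laurent_rest c a b k).
Proof.
move=> s sk; apply: ratfun_compD.
  apply: ratfun_compD; first exact: ratfun_comp_const.
  apply: ratfun_comp_sum => i /sk e; rewrite -{2}e.
  exact: ratfun_compM (ratfun_comp_const _ _) (ratfun_comp_var _ _).
apply: ratfun_comp_sum => i /sk e; rewrite -{2}e.
apply: ratfun_comp_div (ratfun_comp_const _ _) (ratfun_comp_var _ _) _.
by rewrite e; apply: rvar_neq0.
Qed.

(* [x_k] times a Laurent sum, as a quadratic polynomial in [x_k]. *)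
Definition laurent_quadratic c a b k : {poly ratfun F n} :=
  quadratic (rconst n (b k)) (laurent_rest c a b k) (rconst n (a k)).

Lemma laurent_quadratic_indep c a b k i :
  indep_of_var k (laurent_quadratic c a b k)`_i.
Proof.
rewrite coef_Poly; case: i => [|[|[|i]]] /=.
- by move=> s _; apply: ratfun_comp_const.
- exact: laurent_rest_indep.
- by move=> s _; apply: ratfun_comp_const.
- by rewrite nth_nil => s _; apply: ratfun_comp0.
Qed.

Lemma horner_laurent_quadratic c a b k w :
    (forall j, j != k -> w j = rvar F j) -> w k != 0 ->
  (laurent_quadratic c a b k).[w k] = w k * laurent_at c a b w.
Proof.
move=> wk wk0; rewrite horner_quadratic /laurent_at.
rewrite (bigD1 k isT (F := fun i => rconst n (a i) * w i)) /=.
rewrite (bigD1 k isT (F := fun i => rconst n (b i) / w i)) /=.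
rewrite /laurent_rest (laurent_clear _ _ _ _ _ wk0).
by congr (_ * (_ + (_ + _) + (_ + _))); apply: eq_bigr => j /wk ->.
Qed.

Lemma indep_of_varB k f g :
  indep_of_var k f -> indep_of_var k g -> @indep_of_var F n k (f - g).
Proof. by move=> hf hg s sk; apply: ratfun_compB (hf s sk) (hg s sk). Qed.

Lemma indep_of_varM k f g :
  indep_of_var k f -> indep_of_var k g -> @indep_of_var F n k (f * g).
Proof. by move=> hf hg s sk; apply: ratfun_compM (hf s sk) (hg s sk). Qed.

Lemma indep_of_var_coefM k (p q : {poly ratfun F n}) :
    (forall i, indep_of_var k p`_i) -> (forall i, indep_of_var k q`_i) ->
  forall i, indep_of_var k (p * q)`_i.
Proof.
move=> hp hq i s sk; rewrite coefM; apply: ratfun_comp_sum => j _.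
exact: ratfun_compM (hp j s sk) (hq _ s sk).
Qed.

Lemma indep_of_var_deriv k (p : {poly ratfun F n}) :
  (forall i, indep_of_var k p`_i) -> forall i, indep_of_var k p^`()`_i.
Proof.
move=> hp i; rewrite coef_deriv -mulr_natr; apply: indep_of_varM => // s _.
by rewrite -(rmorph_nat (@rconst F n)); apply: ratfun_comp_const.
Qed.

Hypothesis char0 : [pchar F] =i pred0.

(** x_k is transcendental over the functions independent of it, so identities at x_k lift to
    polynomials. *)
Lemma poly_eq_of_horner_rvar k (p q : {poly ratfun F n}) :
    (forall i, indep_of_var k p`_i) -> (forall i, indep_of_var k q`_i) ->
  p.[rvar F k] = q.[rvar F k] -> p = q.
Proof.
move=> hp hq e; apply/eqP; rewrite -subr_eq0; apply/eqP.
apply: (horner_rvar_eq0 char0 (k := k)) => [i|].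
  by rewrite coefB; apply: indep_of_varB.
by rewrite hornerD hornerN e subrr.
Qed.

End Laurent.

(** * The integral [H]: coprimality and nonvanishing of [A k] and [B k] *)

Section TsudaMap.

Variables (F : fieldType) (n : nat).
Hypothesis char0 : [pchar F] =i pred0.
Variables (alpha0 gamma0 : F) (alpha beta gamma delta : 'I_n -> F).
Variable H : ratfun F n.
Hypothesis den_neq0 : laurent_sum gamma0 gamma delta != 0.
Hypothesis HE :
  H = laurent_sum alpha0 alpha beta / laurent_sum gamma0 gamma delta.
Hypothesis H_degree : forall k : 'I_n, degree_in_var k H 2.
Variable phi : ratmap F n.
Hypothesis phiE : forall i : 'I_n,
  phi i = (rvar F i)^-1 *
    ((rconst n (beta i) - rconst n (delta i) * H) /
     (rconst n (alpha i) - rconst n (gamma i) * H)).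

Local Notation num := (laurent_quadratic alpha0 alpha beta).
Local Notation den := (laurent_quadratic gamma0 gamma delta).
Local Notation A i := (rconst n (alpha i) - rconst n (gamma i) * H).
Local Notation B i := (rconst n (beta i) - rconst n (delta i) * H).

Lemma ratfun_char0 : [pchar ratfun F n] =i pred0.
Proof. by move=> p; rewrite (fmorph_pchar (@rconst F n)); apply: char0. Qed.

Lemma laurent_numE :
  laurent_sum alpha0 alpha beta = H * laurent_sum gamma0 gamma delta.
Proof. by rewrite HE mulfVK. Qed.

Lemma horner_rvar_laurent_quadratic c (a b : 'I_n -> F) k :
  (laurent_quadratic c a b k).[rvar F k] = rvar F k * laurent_sum c a b.
Proof.
have := @horner_laurent_quadratic F n c a b k (ratmap_id F n).
rewrite laurent_at_id ffunE; apply; last exact: rvar_neq0.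
by move=> j _; rewrite ffunE.
Qed.

Lemma horner_num k : (num k).[rvar F k] = H * (den k).[rvar F k].
Proof. by rewrite !horner_rvar_laurent_quadratic laurent_numE mulrCA. Qed.

Lemma horner_den_neq0 k : (den k).[rvar F k] != 0.
Proof.
rewrite horner_rvar_laurent_quadratic.
exact: (mulf_neq0 (rvar_neq0 F k) den_neq0).
Qed.

(** The degree hypothesis gives some [p / q] in lowest terms. Cross-multiplication with [num k] and
    [den k] holds at x_k, hence for polynomials, and the size bound 3 leaves no room for a common
    factor. *)
Lemma coprimep_num_den k :
  coprimep (num k) (den k) /\ maxn (size (num k)).-1 (size (den k)).-1 = 2.
Proof.
have [p [q [[hp hq] pq qx e deg]]] := H_degree k.
have sn : (size (num k) <= 3)%N by apply: size_quadratic.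
have sd : (size (den k) <= 3)%N by apply: size_quadratic.
apply: (coprimep_of_degree pq _ _ _ deg sn sd).
- by apply: contraNneq qx => ->; rewrite horner0.
- by apply: contraNneq (horner_den_neq0 k) => ->; rewrite horner0.
apply: (poly_eq_of_horner_rvar char0 (k := k)).
- apply: indep_of_var_coefM => i; first exact: free_of_var_indep.
  exact: laurent_quadratic_indep.
- apply: indep_of_var_coefM => i; last exact: free_of_var_indep.
  exact: laurent_quadratic_indep.
by rewrite !hornerM horner_num e mulrAC (mulfVK qx).
Qed.

Lemma num_den_size k :
  (size (num k) <= 2)%N -> (size (den k) <= 2)%N -> False.
Proof.
by move=> sn sd; have [_] := coprimep_num_den k; rewrite maxnE; lia.
Qed.

Lemma num_den_not_proportional k c : num k <> rconst n c *: den k.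
Proof.
have [cop _] := coprimep_num_den k.
move=> /(coprimep_scale_size cop)[sn sd].
exact: num_den_size (leqW sn) (leqW sd).
Qed.

(** A constant [H] would make [num k] and [den k] proportional. The index [k] supplies a variable in
    which [H] has degree 2. *)
Lemma H_neq_rconst (k : 'I_n) c : H != rconst n c.
Proof.
apply/eqP => e; apply: (@num_den_not_proportional k c).
apply: (poly_eq_of_horner_rvar char0 (k := k)) => [i|i|].
- exact: laurent_quadratic_indep.
- rewrite coefZ; apply: indep_of_varM; last exact: laurent_quadratic_indep.
  by move=> s _; apply: ratfun_comp_const.
- by rewrite hornerZ horner_num e.
Qed.

Lemma rconst_pencil_eq0 (k : 'I_n) a c :
  rconst n a - rconst n c * H = 0 -> a = 0 /\ c = 0.
Proof.
have [->|c0 e] := eqVneq c 0.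
  by rewrite rmorph0 mul0r subr0 => /eqP; rewrite fmorph_eq0 => /eqP.
case/eqP: (H_neq_rconst k (a / c)); rewrite fmorph_div.
have c0' : rconst n c != 0 by rewrite fmorph_eq0.
apply: (mulfI c0'); rewrite mulrCA (mulfV c0') mulr1.
by apply/esym/eqP; rewrite -subr_eq0 e.
Qed.

(** As [H] is not constant, [A k = 0] kills both quadratic coefficients, against degree 2. *)
Lemma pencil_lead_neq0 k : A k != 0.
Proof.
apply/eqP => /(rconst_pencil_eq0 k)[ak ck]; apply: (@num_den_size k).
  by rewrite /laurent_quadratic ak rmorph0 size_quadratic0.
by rewrite /laurent_quadratic ck rmorph0 size_quadratic0.
Qed.

(** Otherwise both constant coefficients vanish and 0 is a common root of coprime polynomials. *)
Lemma pencil_tail_neq0 k : B k != 0.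
Proof.
apply/eqP => /(rconst_pencil_eq0 k)[bk dk]; have [cop _] := coprimep_num_den k.
have num0 : root (num k) 0.
  by rewrite /root horner_quadratic bk rmorph0 expr2 !mulr0 !addr0.
have := coprimep_root cop num0.
by rewrite horner_quadratic dk rmorph0 expr2 !mulr0 !addr0 eqxx.
Qed.

Lemma phi_neq0 k : phi k != 0.
Proof.
rewrite phiE; apply: (mulf_neq0 (invr_neq0 (rvar_neq0 F k))).
exact: (mulf_neq0 (pencil_tail_neq0 k) (invr_neq0 (pencil_lead_neq0 k))).
Qed.

(** * The quadratic equation for the new coordinate X_k *)

Definition pencil_mid k :=
  laurent_rest alpha0 alpha beta k - laurent_rest gamma0 gamma delta k * H.

(** With [H] held fixed as a scalar, its vanishing is the equation of [sigma^k] for [y], cleared of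
    denominators; x_k is one root. *)
Lemma horner_pencil k y :
  (num k).[y] - H * (den k).[y] = B k + pencil_mid k * y + A k * y ^+ 2.
Proof. exact: quadratic_pencil. Qed.

Lemma pencil_rvar k :
  B k + pencil_mid k * rvar F k + A k * rvar F k ^+ 2 = 0.
Proof. by rewrite -horner_pencil horner_num subrr. Qed.

(** If they were equal, x_k would be a double root of the pencil: both [num k = H * den k] and its
    derivative in x_k with [H] fixed hold at x_k. Eliminating [H] makes the Wronskian vanish, which
    coprimality in degree 2 forbids. *)
Lemma phi_neq_rvar k : phi k != rvar F k.
Proof.
apply/eqP; rewrite phiE => e; have [cop _] := coprimep_num_den k.
have d0 := quadratic_double_root (pencil_lead_neq0 k) (rvar_neq0 F k)
  (pencil_rvar k) e.
suff [sn sd] : (size (num k) <= 1)%N /\ (size (den k) <= 1)%N.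
  exact: num_den_size (leqW sn) (leqW sd).
apply: (coprimep_wronskian_size ratfun_char0 cop).
have hn i : indep_of_var k (num k)`_i by apply: laurent_quadratic_indep.
have hd i : indep_of_var k (den k)`_i by apply: laurent_quadratic_indep.
apply: (poly_eq_of_horner_rvar char0 (k := k)).
- by apply: indep_of_var_coefM => //; apply: indep_of_var_deriv.
- by apply: indep_of_var_coefM => //; apply: indep_of_var_deriv.
rewrite !hornerM horner_num.
have -> : (num k)^`().[rvar F k] = H * (den k)^`().[rvar F k].
  apply/eqP; rewrite -subr_eq0 -d0 /pencil_mid !horner_deriv_quadratic.
  apply/eqP; exact: pencil_deriv.
by rewrite mulrAC.
Qed.

(** Invariance of [H] cleared of denominators, so that it is available before the denominator at
    [mixed phi m] is known to be nonzero. *)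
Lemma pencil_mixed m :
  laurent_at alpha0 alpha beta (mixed phi m) =
  H * laurent_at gamma0 gamma delta (mixed phi m).
Proof.
pose pencil (w : ratmap F n) :=
  rconst n alpha0 - rconst n gamma0 * H + \sum_i (A i * w i + B i / w i).
have pencilE w : laurent_at alpha0 alpha beta w
    - H * laurent_at gamma0 gamma delta w = pencil w.
  rewrite /pencil /laurent_at big_split /= -!sumr_pencil.
  exact: pencil_split.
have mixedE : pencil (mixed phi m) = pencil (ratmap_id F n).
  congr (_ + _); apply: eq_bigr => i _; rewrite !ffunE.
  case: ifP => // _; rewrite phiE.
  by apply: involution_term (rvar_neq0 F i);
    [apply: pencil_lead_neq0 | apply: pencil_tail_neq0].
apply/eqP; rewrite -subr_eq0 pencilE mixedE -pencilE !laurent_at_id.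
by rewrite laurent_numE subrr.
Qed.

Lemma mixed_neq0 m i : mixed phi m i != 0.
Proof.
by rewrite ffunE; case: ifP => _; [apply: phi_neq0 | apply: rvar_neq0].
Qed.

(** By [pencil_mixed] the numerator vanishes wherever this denominator does, so this excludes the
    indeterminate form 0/0. *)
Definition nondegenerate m := laurent_at gamma0 gamma delta (mixed phi m) != 0.

Lemma ratfun_comp_laurent_sum c (a b : 'I_n -> F) (w : ratmap F n) :
    (forall i, w i != 0) ->
  ratfun_comp (laurent_sum c a b) w (laurent_at c a b w).
Proof.
move=> w0; rewrite -laurent_at_id.
exact: ratfun_comp_laurent (@ratmap_comp_id F n w) w0.
Qed.

Lemma ratfun_comp_H m : nondegenerate m -> ratfun_comp H (mixed phi m) H.
Proof.
move=> nd; have -> : H = laurent_at alpha0 alpha beta (mixed phi m)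
    / laurent_at gamma0 gamma delta (mixed phi m) by rewrite pencil_mixed mulfK.
(* Only the first occurrence returns to [H]; the quotient on the right is the composite computed
   term by term. *)
rewrite {1}pencil_mixed (mulfK nd) HE.
apply: ratfun_comp_div nd; apply: ratfun_comp_laurent_sum; exact: mixed_neq0.
Qed.

(** The inner map preserves [H], hence each [A i] and [B i]; a coordinate in both sets is inverted
    twice and returns to x_i. Only the inner map has to be nondegenerate. *)
Lemma mixed_comp m m' :
    nondegenerate m' ->
  ratmap_comp (mixed phi m) (mixed phi m')
    (mixed phi [set i | (i \in m) (+) (i \in m')]).
Proof.
move=> nd i; rewrite [mixed phi m i]ffunE [X in ratfun_comp _ _ X]ffunE inE.
case: (i \in m) => /=; last first.
  by have := ratfun_comp_var i (mixed phi m'); rewrite ffunE.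
have hA := ratfun_compB (ratfun_comp_const (alpha i) (mixed phi m'))
  (ratfun_compM (ratfun_comp_const (gamma i) _) (ratfun_comp_H nd)).
have hB := ratfun_compB (ratfun_comp_const (beta i) (mixed phi m'))
  (ratfun_compM (ratfun_comp_const (delta i) _) (ratfun_comp_H nd)).
have hV := ratfun_compV (ratfun_comp_var i (mixed phi m')) (mixed_neq0 m' i).
have := ratfun_compM hV (ratfun_comp_div hB hA (pencil_lead_neq0 i)).
rewrite -phiE [in X in _ -> X]fun_if if_neg ffunE; case: ifP => _; last first.
  by rewrite -phiE.
rewrite [in X in ratfun_comp _ _ X]phiE.
by rewrite (involution_twice (pencil_lead_neq0 i) (pencil_tail_neq0 i)
  (rvar_neq0 F i)).
Qed.

Lemma mixed_set0 : mixed phi set0 = ratmap_id F n.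
Proof. by apply/ffunP => i; rewrite !ffunE inE. Qed.

Lemma mixed_setT : mixed phi setT = phi.
Proof. by apply/ffunP => i; rewrite !ffunE inE. Qed.

Lemma nondegenerate_set0 : nondegenerate set0.
Proof. by rewrite /nondegenerate mixed_set0 laurent_at_id. Qed.

(** If the denominator vanished, so would the numerator, and [phi k] would be a common root of
    [num k] and [den k]. *)
Lemma nondegenerate_set1 k : nondegenerate [set k].
Proof.
have [cop _] := coprimep_num_den k; apply/negP => /eqP den0.
have wk j : j != k -> mixed phi [set k] j = rvar F j.
  by rewrite ffunE inE => /negPf ->.
have num0 : root (num k) (mixed phi [set k] k).
  rewrite /root horner_laurent_quadratic ?mixed_neq0 //.
  by rewrite pencil_mixed den0 !mulr0.
have := coprimep_root cop num0.
by rewrite horner_laurent_quadratic ?mixed_neq0 // den0 mulr0 eqxx.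
Qed.

Lemma mixed_involutive m :
  nondegenerate m -> ratmap_comp (mixed phi m) (mixed phi m) (ratmap_id F n).
Proof.
move=> nd; have := mixed_comp m nd.
rewrite (_ : [set i | _ (+) _] = set0) ?mixed_set0 //.
by apply/setP => i; rewrite !inE addbb.
Qed.

(* The value of the denominator at [mixed phi (k |: m)] is obtained from its
   value at [mixed phi [set k]] by composition with the involution
   [mixed phi m]. *)
Lemma nondegenerate_all m : nondegenerate m.
Proof.
suff main c : forall m' : {set 'I_n}, (#|m'| <= c)%N -> nondegenerate m'.
  exact: main _ m (leqnn _).
elim: c => [|c IH] {}m.
  by rewrite leqn0 cards_eq0 => /eqP ->; apply: nondegenerate_set0.
have [->|[k km]] := set_0Vmem m; first by move=> _; apply: nondegenerate_set0.
rewrite (cardsD1 k) km ltnS => /IH nd.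
have := mixed_comp [set k] nd.
rewrite (_ : [set i | _ (+) _] = m) => [hk|]; last first.
  by apply/setP => i; rewrite !inE; have [->|] := eqVneq i k; rewrite ?km.
apply: ratfun_comp_neq0 (mixed_involutive nd) _ (nondegenerate_set1 k).
exact: ratfun_comp_laurent hk (mixed_neq0 m).
Qed.

Lemma phi_involutive : ratmap_comp phi phi (ratmap_id F n).
Proof.
by rewrite -mixed_setT; apply: mixed_involutive (nondegenerate_all _).
Qed.

Lemma two_n_rational_narrow_phi : two_n_rational_narrow phi.
Proof.
have inv m := mixed_involutive (nondegenerate_all m).
have companion m : ratmap_comp (mixed phi (~: m)) (mixed phi m) phi.
  have := mixed_comp (~: m) (nondegenerate_all m).
  rewrite (_ : [set i | _ (+) _] = setT) ?mixed_setT //.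
  by apply/setP => i; rewrite !inE; case: (i \in m).
have phiK := phi_involutive.
split=> [m|m C [S [mS Sm] hC]]; first by exists phi, (mixed phi m).
(* The inverse [S] in the definition of a companion is forced, so the companion is unique. *)
have eS : S = mixed phi m := ratmap_involution_inverse (inv m) Sm.
by have -> : C = phi by apply: ratmap_comp_uniq hC _; rewrite eS.
Qed.

(** * The involutions [sigma^k] and their composite *)

Lemma is_sigma_mixed k : is_sigma H k (mixed phi [set k]).
Proof.
split; last exact: ratfun_comp_H (nondegenerate_all _).
  by move=> j /negPf jk; rewrite ffunE inE jk.
by rewrite ffunE inE eqxx phi_neq_rvar.
Qed.

(** Composing [num k = H * den k] at x_k with [s] shows that [s k] is a root of the pencil other
    than x_k; by Vieta it is [phi k]. *)
Lemma is_sigma_uniq k s : is_sigma H k s -> s = mixed phi [set k].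
Proof.
move=> [sk sk_neq sH]; apply/ffunP => i; rewrite ffunE inE.
have [->|/sk //] := eqVneq i k; rewrite phiE.
apply: (quadratic_other_root (pencil_lead_neq0 k) (rvar_neq0 F k) sk_neq
  (pencil_rvar k)).
have hn := ratfun_comp_horner
  (fun i => @laurent_quadratic_indep F n alpha0 alpha beta k i) sk.
have hd := ratfun_comp_horner
  (fun i => @laurent_quadratic_indep F n gamma0 gamma delta k i) sk.
rewrite -horner_pencil; apply/eqP; rewrite subr_eq0; apply/eqP.
by apply: ratfun_comp_uniq hn _; rewrite horner_num; apply: ratfun_compM.
Qed.

(** Without repetitions in [l], the symmetric differences are disjoint unions. *)
Lemma ratmap_comp_seq_mixed (l : seq 'I_n) w :
    uniq l ->
  ratmap_comp_seq [seq mixed phi [set k] | k <- l] w <->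
    w = mixed phi [set k in l].
Proof.
elim: l w => [|k l IH] w /=.
  by rewrite (_ : [set _ in _] = set0) ?mixed_set0.
move=> /andP[kl /IH {}IH].
have := mixed_comp [set i in l] (nondegenerate_all [set k]).
rewrite (_ : [set i | _ (+) _] = [set i in k :: l]) => [hk|]; last first.
  by apply/setP => i; rewrite !inE; have [->|] := eqVneq i k;
    rewrite ?(negPf kl) ?addbF.
split=> [[v /IH -> hw]|->]; first exact: ratmap_comp_uniq hw hk.
by exists (mixed phi [set i in l]); first exact/IH.
Qed.

Lemma is_tsuda_map_phi psi : is_tsuda_map H psi <-> psi = phi.
Proof.
have seqE := ratmap_comp_seq_mixed psi (enum_uniq 'I_n).
have setE : [set k in enum 'I_n] = setT.
  by apply/setP => i; rewrite !inE mem_enum.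
rewrite setE mixed_setT in seqE.
split=> [[sigma hsigma hpsi]|/seqE hpsi].
  have sigmaE : sigma =1 (fun k => mixed phi [set k]).
    by move=> k; apply: is_sigma_uniq.
  by apply/seqE; rewrite -(eq_map sigmaE).
exists (fun k => mixed phi [set k]); last exact: hpsi.
by move=> k; apply: is_sigma_mixed.
Qed.

End TsudaMap.

Theorem proposition3p1 (R : realType) (n : nat) (hn : (1 <= n)%N)
    (alpha0 gamma0 : R[i]) (alpha beta gamma delta : 'I_n -> R[i])
    (H : ratfun R[i] n)
    (hden : laurent_sum gamma0 gamma delta != 0)
    (hH : H = laurent_sum alpha0 alpha beta / laurent_sum gamma0 gamma delta)
    (hdeg : forall k : 'I_n, degree_in_var k H 2)
    (phi : ratmap R[i] n)
    (hphi : forall i : 'I_n,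
       phi i = (rvar R[i] i)^-1 *
         ((rconst n (beta i) - rconst n (delta i) * H) /
          (rconst n (alpha i) - rconst n (gamma i) * H))) :
  (forall i : 'I_n, rconst n (alpha i) - rconst n (gamma i) * H != 0) /\
  (forall psi : ratmap R[i] n, is_tsuda_map H psi <-> psi = phi) /\
  ratmap_comp phi phi (ratmap_id R[i] n) /\
  two_n_rational_narrow phi.
Proof.
have char0 : [pchar R[i]] =i pred0 by apply: (pchar_num R[i]).
split; first exact: (pencil_lead_neq0 char0 hden hH hdeg).
split; first exact: (is_tsuda_map_phi char0 hden hH hdeg hphi).
split; first exact: (phi_involutive char0 hden hH hdeg hphi).
exact: (two_n_rational_narrow_phi char0 hden hH hdeg hphi).
Qed.
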